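(* $$\mathrm{ex}_{C_5}(n,K_3)=(1+o(1))\frac{n^2}{25}\qquad (n\to\infty).$$
   Context: For fixed nonempty simple graphs $F$ and $G$, $\mathrm{ex}_F(n,G)$ denotes the maximum number of pairwise edge-disjoint copies of $F$ that can be placed on an $n$-element vertex set so that the union of these copies contains no subgraph isomorphic to $G$ all of whose edges belong to pairwise different copies of $F$. $C_5$ is the cycle of length $5$ and $K_3$ the triangle. *)

(* Defs.v *)
From mathcomp Require Import all_boot.

Set Implicit Arguments.
Unset Strict Implicit.
Unset Printing Implicit Defensive.

Record sgraph := SGraph {
  vertex :> finType;
  adj : rel vertex;
  adj_sym : symmetric adj;
  adj_irr : irreflexive adj }.

Definition edges (G : sgraph) : {set {set G}} :=
  [set [set x; y] | x : G, y : G in adj x].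

Lemma complete_sym n : symmetric (fun x y : 'I_n => x != y).
Proof. by move=> x y; rewrite eq_sym. Qed.

Lemma complete_irr n : irreflexive (fun x y : 'I_n => x != y).
Proof. by move=> x; rewrite eqxx. Qed.

Definition complete_graph (n : nat) : sgraph :=
  SGraph (@complete_sym n) (@complete_irr n).

(* The cycle of length n when n >= 3; [ordS] is the successor modulo n. *)
Definition cycle_adj n : rel 'I_n :=
  fun x y => (x != y) && ((ordS x == y) || (ordS y == x)).

Lemma cycle_adj_sym n : symmetric (@cycle_adj n).
Proof. by move=> x y; rewrite /cycle_adj eq_sym orbC. Qed.

Lemma cycle_adj_irr n : irreflexive (@cycle_adj n).
Proof. by move=> x; rewrite /cycle_adj eqxx. Qed.

Definition cycle_graph (n : nat) : sgraph :=
  SGraph (@cycle_adj_sym n) (@cycle_adj_irr n).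

(* A copy of F on the vertex set V is represented by its edge set, so that two
   copies differing only in isolated vertices are identified; edge-disjoint
   copies of a graph with at least one edge always have distinct edge sets. *)
Definition copies (V : finType) (F : sgraph) : {set {set {set V}}} :=
  [set [set f @: e | e : {set F} in edges F] | f : {ffun F -> V} & injectiveb f].

Definition packing (V : finType) (F : sgraph) (P : {set {set {set V}}}) : bool :=
  (P \subset copies V F) && trivIset P.

(* [cover P] is the edge set of the union of the members of P. The edges of C
   lie in pairwise different members of P when no member contains two of them. *)
Definition rainbow_copy (V : finType) (G : sgraph) (P : {set {set {set V}}})
    (C : {set {set V}}) : bool :=
  [&& C \in copies V G, C \subset cover P & [forall A in P, #|A :&: C| <= 1]].

(* ex_F(n, G), for F and G with at least one edge each. *)
Definition exF (F : sgraph) (n : nat) (G : sgraph) : nat :=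
  \max_(P : {set {set {set 'I_n}}}
         | packing F P && ~~ [exists C, rainbow_copy G P C]) #|P|.

(* Main.v *)
(** Lower bound: the balanced blow-up of [C_5] with parts of size [m = n / 5] is
    triangle-free, and the [m^2] pentagons with labels [(a, b, a, b, a + b)],
    for [a, b] in Z/m, are pairwise edge-disjoint, since two consecutive labels
    determine [(a, b)].

    Upper bound: let [d] be the degree in the union of a packing [P], and let [k]
    count the pentagons through a vertex, so that [d = 2 k].  Summing [d] over
    the vertices of all pentagons gives [2 sum_x k(x)^2], which is at least
    [50 |P|^2 / n] by Cauchy-Schwarz.  Counted the other way, it is the sum over
    pairs [(A, w)] of the number of neighbours of [w] on the pentagon [A].  This
    number is at most 2 unless [w] sees an edge [xy] of [A].  In that case, since
    the triangle [wxy] is not rainbow, either [w] lies on [A] or [wx] and [wy]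
    lie in a common pentagon [B].  In the latter case [(B, w)] determines [xy]
    and hence [A], so there are at most [10 |P|] exceptional pairs.  This yields
    [25 |P| <= n^2 + 15 n] without the triangle removal lemma. *)
Require Import Defs.
From mathcomp Require Import all_boot all_order all_algebra zify ring lra.

Set Implicit Arguments.
Unset Strict Implicit.
Unset Printing Implicit Defensive.

(** * Copies of a graph as edge sets *)

Lemma pair_set_eq (T : finType) (x y u v : T) :
  [set x; y] = [set u; v] -> (x = u /\ y = v) \/ (x = v /\ y = u).
Proof.
move=> E.
have := set21 x y; rewrite E !inE => /orP[]/eqP xE; subst x.
- left; split=> //.
  have := set22 u y; rewrite E !inE => /orP[]/eqP yE //; subst y.
  by have := set22 u v; rewrite -E !inE orbb => /eqP.
- right; split=> //.
  have := set22 v y; rewrite E !inE => /orP[]/eqP yE //; subst y.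
  by have := set21 u v; rewrite -E !inE orbb => /eqP.
Qed.

Lemma copyP (V : finType) (F : sgraph) (A : {set {set V}}) :
  reflect (exists2 f : {ffun F -> V}, injective f &
             A = [set f @: e | e : {set F} in edges F])
          (A \in copies V F).
Proof.
apply: (iffP imsetP) => [[f]|[f fI ->]]; last by exists f; rewrite ?inE //; apply/injectiveP.
by rewrite inE => /injectiveP fI ->; exists f.
Qed.

Lemma copy_edgeP (V : finType) (F : sgraph) (f : {ffun F -> V}) (e : {set V}) :
  reflect (exists i j : F, adj i j /\ e = [set f i; f j])
          (e \in [set f @: e | e : {set F} in edges F]).
Proof.
apply: (iffP imsetP) => [[e0]|[i [j [ij ->]]]].
  by case/imset2P=> i j _; rewrite unfold_in => ij -> ->; exists i, j; rewrite imsetU1 imset_set1.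
exists [set i; j]; last by rewrite imsetU1 imset_set1.
by apply/imset2P; exists i j.
Qed.

Lemma copy_edge_neq (V : finType) (F : sgraph) (A : {set {set V}}) x y :
  A \in copies V F -> [set x; y] \in A -> x != y.
Proof.
case/copyP=> f fI -> /copy_edgeP[i [j [ij E]]].
have nij : f i != f j.
  by apply/eqP => /fI ij'; move: ij; rewrite ij' (adj_irr j).
by case: (pair_set_eq E) => -[-> ->] //; rewrite eq_sym.
Qed.

(** * The five-cycle: degrees, independent sets, triangles *)

Lemma card_ord5 (p : pred 'I_5) :
  #|[set i | p i]| =
  p (@Ordinal 5 0 isT) + p (@Ordinal 5 1 isT) + p (@Ordinal 5 2 isT)
  + p (@Ordinal 5 3 isT) + p (@Ordinal 5 4 isT).
Proof.
rewrite -sum1_card (eq_bigl p) => [|i]; last by rewrite inE.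
rewrite big_mkcond !big_ord_recr big_ord0 /= add0n.
have E (i j : 'I_5) : val i = val j -> (if p i then 1 else 0) = p j.
  by move/val_inj->; case: (p j).
by congr (_ + _ + _ + _ + _); apply: E.
Qed.

Lemma cycle5_degree (i : 'I_5) : #|[set j | cycle_adj i j]| = 2.
Proof. by rewrite card_ord5; case: i => [[|[|[|[|[|]]]]]]. Qed.

Lemma cycle5_no_large_independent (S : {set 'I_5}) :
  2 < #|S| -> exists i j, [/\ i \in S, j \in S & cycle_adj i j].
Proof.
case: (boolP [exists i, (i \in S) && (ordS i \in S)]) => [/existsP[i /andP[iS jS]] _|].
  exists i, (ordS i); split=> //.
  by case: i {iS jS} => [[|[|[|[|[|]]]]]].
(* Five constraints, one for each pair of consecutive indices, remain; they leave a Boolean check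
   over the membership patterns of [S]. *)
move/existsPn => nS.
have := nS (@Ordinal 5 0 isT); have := nS (@Ordinal 5 1 isT).
have := nS (@Ordinal 5 2 isT); have := nS (@Ordinal 5 3 isT).
have := nS (@Ordinal 5 4 isT).
have -> : #|S| = #|[set i | i \in S]| by rewrite cardsE; apply: eq_card => i.
rewrite card_ord5.
have E i k (h : k < 5) : val (ordS i) = k -> ordS i = Ordinal h.
  by move=> ?; apply: val_inj.
rewrite (E (@Ordinal 5 4 isT) 0 isT) // (E (@Ordinal 5 0 isT) 1 isT) //.
rewrite (E (@Ordinal 5 1 isT) 2 isT) // (E (@Ordinal 5 2 isT) 3 isT) //.
rewrite (E (@Ordinal 5 3 isT) 4 isT) //.
by do 5![case: (_ \in S)].
Qed.

Lemma cycle5_triangle_free (i j k : 'I_5) :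
  cycle_adj i j -> cycle_adj i k -> cycle_adj j k -> False.
Proof.
by case: i => [[|[|[|[|[|]]]]]] //= ?; case: j => [[|[|[|[|[|]]]]]] //= ?;
   case: k => [[|[|[|[|[|]]]]]].
Qed.

(** * Pentagons and triangles on a vertex set *)

Section CycleCopies.
Variable V : finType.
Implicit Types (A C : {set {set V}}) (P : {set {set {set V}}}) (x y w : V).

Definition nbr A x : {set V} := [set y | [set x; y] \in A].

Lemma cycle5_copyP A : A \in copies V (cycle_graph 5) ->
  exists2 f : 'I_5 -> V, injective f &
    forall e, e \in A <-> exists i j, cycle_adj i j /\ e = [set f i; f j].
Proof.
case/copyP=> f fI AE; exists f => // e.
by rewrite AE; split=> [/copy_edgeP|?] //; apply/copy_edgeP.
Qed.

Lemma cover_cycle5_copy A (f : 'I_5 -> V) :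
  (forall e, e \in A <-> exists i j, cycle_adj i j /\ e = [set f i; f j]) ->
  cover A = f @: setT.
Proof.
move=> AP; apply/setP=> x; apply/bigcupP/imsetP.
  case=> e /AP[i [j [_ ->]]]; rewrite !inE => /orP[]/eqP->; by [exists i | exists j].
case=> i _ ->; exists [set f i; f (ordS i)]; last exact: set21.
apply/AP; exists i, (ordS i); split=> //.
by case: i => [[|[|[|[|[|]]]]]].
Qed.

Lemma card_cover_cycle5_copy A :
  A \in copies V (cycle_graph 5) -> #|cover A| = 5.
Proof.
by case/cycle5_copyP=> f fI /cover_cycle5_copy ->; rewrite card_imset // cardsT card_ord.
Qed.

Lemma card_nbr_cycle5_copy A x :
  A \in copies V (cycle_graph 5) -> #|nbr A x| = 2 * (x \in cover A).
Proof.
case/cycle5_copyP=> f fI AP; have cA := cover_cycle5_copy AP.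
have [|xA] := boolP (x \in cover A).
  rewrite cA => /imsetP[i _ ->].
  rewrite muln1 -(cycle5_degree i) -(card_imset (mem [set j | cycle_adj i j]) fI); apply: eq_card => y.
  rewrite inE; apply/idP/imsetP.
    case/AP=> j [k [jk /pair_set_eq[][/fI -> ->]]]; first by exists k; rewrite ?inE.
    by exists j => //; rewrite inE cycle_adj_sym.
  by case=> j; rewrite inE => ij ->; apply/AP; exists i, j.
apply/eqP; rewrite cards_eq0; apply/eqP/setP=> y; rewrite !inE.
apply: contraNF xA => xyA; apply/bigcupP; exists [set x; y] => //; exact: set21.
Qed.

Lemma cycle5_copy_large_set A (S : {set V}) :
  A \in copies V (cycle_graph 5) -> S \subset cover A -> 2 < #|S| ->
  exists x y, [/\ x \in S, y \in S & [set x; y] \in A].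
Proof.
case/cycle5_copyP=> f fI AP; rewrite (cover_cycle5_copy AP) => /subsetP sS.
have SE : S = f @: (f @^-1: S).
  apply/setP=> x; apply/idP/imsetP; last by case=> i; rewrite inE => ? ->.
  by move=> xS; have /imsetP[i _ xE] := sS x xS; exists i; rewrite // inE -xE.
rewrite {1}SE card_imset // => /cycle5_no_large_independent[i [j []]].
rewrite !inE => iS jS ij; exists (f i), (f j); split=> //.
by apply/AP; exists i, j.
Qed.

Lemma triangle_copy x y w : x != y -> x != w -> y != w ->
  [set [set x; y]; [set x; w]; [set y; w]] \in copies V (complete_graph 3).
Proof.
move=> xy xw yw; pose f : {ffun 'I_3 -> V} := [ffun i : 'I_3 => nth x [:: x; y; w] i].
have f0 h : f (@Ordinal 3 0 h) = x by rewrite ffunE.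
have f1 h : f (@Ordinal 3 1 h) = y by rewrite ffunE.
have f2 h : f (@Ordinal 3 2 h) = w by rewrite ffunE.
apply/copyP; exists f.
  move=> i j; rewrite !ffunE => /eqP.
  rewrite nth_uniq ?(ltn_ord i) ?(ltn_ord j) // => [/eqP/val_inj //|].
  by rewrite /= !inE negb_or xy xw yw.
apply/setP=> e; rewrite !inE; apply/idP/copy_edgeP.
  case/orP=> [/orP[]|] /eqP->.
  - by exists (@Ordinal 3 0 isT), (@Ordinal 3 1 isT); rewrite f0 f1.
  - by exists (@Ordinal 3 0 isT), (@Ordinal 3 2 isT); rewrite f0 f2.
  - by exists (@Ordinal 3 1 isT), (@Ordinal 3 2 isT); rewrite f1 f2.
case=> [[[|[|[|]]] hi]] // [[[|[|[|]]] hj]] // [] // _ ->;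
  rewrite ?f0 ?f1 ?f2 ?eqxx ?orbT //.
- by rewrite [X in X == _]setUC eqxx.
- by rewrite [[set w; x]]setUC eqxx orbT.
- by rewrite [[set w; y]]setUC eqxx !orbT.
Qed.

End CycleCopies.

(** * Counting tools: indicators, disjoint families, Cauchy-Schwarz *)

Lemma card_set_sum (T : finType) (p : pred T) : #|[set x | p x]| = \sum_x p x.
Proof. by rewrite -sum1dep_card big_mkcond; apply: eq_bigr => x _; case: (p x). Qed.

Lemma trivIset_unique (T : finType) (P : {set {set T}}) (A B : {set T}) (e : T) :
  trivIset P -> A \in P -> B \in P -> e \in A -> e \in B -> A = B.
Proof.
move=> tP AP BP eA eB; apply/eqP; apply: contraT => nAB.
by move/trivIsetP: tP => /(_ A B AP BP nAB)/disjointFr/(_ eA); rewrite eB.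
Qed.

Lemma trivIset_mem_cover (T : finType) (P : {set {set T}}) (e : T) :
  trivIset P -> (e \in cover P) = \sum_(A in P) (e \in A) :> nat.
Proof.
move=> tP; have [/bigcupP[A AP eA]|eP] := boolP (e \in cover P).
  rewrite (bigD1 A) //= eA big1 ?addn0 // => B /andP[BP]; apply: contraNeq.
  by rewrite eqb0 negbK => eB; rewrite (trivIset_unique tP BP AP eB eA).
rewrite big1 // => A AP; apply/eqP; rewrite eqb0; apply: contra eP => eA.
by apply/bigcupP; exists A.
Qed.

(** After doubling, both sides are double sums over pairs, compared termwise by $2k(x)k(y) \le
    k(x)^2 + k(y)^2$. *)
Lemma sum_nat_sqr_le (T : finType) (k : T -> nat) :
  (\sum_x k x) ^ 2 <= #|T| * \sum_x k x ^ 2.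
Proof.
rewrite -(leq_pmul2l (isT : 0 < 2)) -mulnn big_distrl big_distrr /=.
have -> : 2 * (#|T| * \sum_x k x ^ 2) = \sum_x \sum_y (k x ^ 2 + k y ^ 2).
  apply/esym; under eq_bigr do rewrite big_split sum_nat_const /=.
  by rewrite big_split -big_distrr sum_nat_const mul2n -addnn.
apply: leq_sum => x _; rewrite !big_distrr /=.
by apply: leq_sum => y _; exact: nat_Cauchy.
Qed.

(** * Upper bound for packings without a rainbow triangle *)

Section UpperBound.
Variables (V : finType) (P : {set {set {set V}}}).
Hypothesis packP : packing (cycle_graph 5) P.
Hypothesis noRainbow : ~~ [exists C, rainbow_copy (complete_graph 3) P C].
Implicit Types (A B : {set {set V}}) (x y w : V).

Let trivP : trivIset P. Proof. by case/andP: packP. Qed.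

Let copyP5 A : A \in P -> A \in copies V (cycle_graph 5).
Proof. by case/andP: packP => /subsetP + _; apply. Qed.

Definition multiplicity x : nat := \sum_(A in P) (x \in cover A).

(** Each pentagon through [x] supplies two neighbours, and edge-disjointness prevents any neighbour
    from being counted twice. *)
Lemma degree_multiplicity x : #|nbr (cover P) x| = 2 * multiplicity x.
Proof.
rewrite card_set_sum; under eq_bigr do rewrite (trivIset_mem_cover _ trivP).
rewrite exchange_big /multiplicity big_distrr /=; apply: eq_bigr => A /copyP5 AC.
by rewrite -card_set_sum -(card_nbr_cycle5_copy x AC).
Qed.

Lemma sum_multiplicity : \sum_x multiplicity x = 5 * #|P|.
Proof.
rewrite exchange_big mulnC -sum_nat_const /=; apply: eq_bigr => A /copyP5 AC.
by rewrite -card_set_sum -(card_cover_cycle5_copy AC); apply: eq_card => x; rewrite inE.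
Qed.

Definition codegree A w : nat := #|[set x in cover A | x \in nbr (cover P) w]|.

(** A vertex [x] lies on $k(x)$ pentagons [A] and is adjacent to $2k(x)$ vertices [w], so it
    contributes $2k(x)^2$ to the sum. *)
Lemma sum_codegree :
  \sum_(A in P) \sum_w codegree A w = 2 * \sum_x multiplicity x ^ 2.
Proof.
rewrite big_distrr /=.
have E A : \sum_w codegree A w = \sum_x (x \in cover A) * (2 * multiplicity x).
  under eq_bigr do rewrite /codegree card_set_sum.
  rewrite exchange_big; apply: eq_bigr => x _ /=.
  rewrite -degree_multiplicity card_set_sum big_distrr /=; apply: eq_bigr => w _.
  by rewrite inE setUC mulnb.
under eq_bigr do rewrite E.
rewrite exchange_big; apply: eq_bigr => x _ /=.
by rewrite -big_distrl /= mulnCA mulnn.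
Qed.

(** This marks [(A, w)] as an exceptional pair witnessed by [B]: the triangle on [w] and an edge of
    [A] has its two other edges in [B]. *)
Definition spans A B w : bool :=
  [exists x, exists y, [&& [set x; y] \in A, x \in nbr B w & y \in nbr B w]].

(** The codegree never exceeds $5 = 2 + 3$, so each exception costs at most 3. If it exceeds 2,
    three neighbours of [w] on the pentagon include an edge [xy] of [A], and the triangle [wxy] has
    two edges in one member of [P]. *)
Lemma codegree_le A w : A \in P ->
  codegree A w <= 2 + 3 * (w \in cover A) + 3 * \sum_(B in P) spans A B w.
Proof.
move=> AP; have AC := copyP5 AP.
have [c2|c3] := leqP (codegree A w) 2; first by rewrite -addnA (leq_trans c2) ?leq_addr.
have sub : [set x in cover A | x \in nbr (cover P) w] \subset cover A.
  by apply/subsetP=> x; rewrite inE => /andP[].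
have c5 : codegree A w <= 5 by rewrite -(card_cover_cycle5_copy AC) subset_leq_card.
suff : (w \in cover A) \/ exists2 B, B \in P & spans A B w.
  case=> [->|[B BP AB]].
    by apply: (leq_trans c5); rewrite muln1 leq_addr.
  by apply: (leq_trans c5); rewrite (bigD1 B) //= AB; lia.
have [x [y [+ + xyA]]] := cycle5_copy_large_set AC sub c3.
rewrite !inE => /andP[_ wxP] /andP[_ wyP].
have neqP u v : [set u; v] \in cover P -> u != v.
  by case/bigcupP=> B /copyP5 BC; exact: copy_edge_neq BC.
have xy : x != y := copy_edge_neq AC xyA.
have xw : x != w by rewrite eq_sym neqP.
have yw : y != w by rewrite eq_sym neqP.
have /forallPn[B] : ~~ [forall B in P,
    #|B :&: [set [set x; y]; [set x; w]; [set y; w]]| <= 1].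
  apply: contra noRainbow => nB; apply/existsP; eexists; apply/and3P; split; last exact: nB.
    exact: triangle_copy.
  rewrite [[set x; w]]setUC [[set y; w]]setUC !subUset !sub1set wxP wyP !andbT.
  by apply/bigcupP; exists A.
rewrite negb_imply -ltnNge => /andP[BP /card_gt1P[e1 [e2 []]]].
rewrite !inE => /andP[e1B e1E] /andP[e2B e2E] e12.
have wxA u : [set u; w] \in A -> w \in cover A.
  by move=> uwA; apply/bigcupP; exists [set u; w] => //; exact: set22.
have wxB u : [set x; y] \in B -> [set u; w] \in B -> w \in cover A.
  by move=> xyB; rewrite (trivIset_unique trivP BP AP xyB xyA); exact: wxA.
have both : [set x; w] \in B -> [set y; w] \in B -> exists2 B, B \in P & spans A B w.
  move=> xwB ywB; exists B => //; apply/existsP; exists x; apply/existsP; exists y.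
  by rewrite xyA !inE setUC xwB setUC.
(* If [xy] is one of the two edges in [B], then [B = A] and [w] lies on [A]; otherwise they are [xw]
   and [yw], and [B] is a witness. *)
case/orP: e1E e1B e12 => [/orP[]|] /eqP->; case/orP: e2E e2B => [/orP[]|] /eqP->;
  rewrite ?eqxx //; eauto.
Qed.

(** On [B] the vertex [w] has no neighbour or exactly two. In the second case the spanned edge must
    be that pair, and an edge belongs to only one member of [P]. *)
Lemma sum_spans_le B w : B \in P -> \sum_(A in P) spans A B w <= (w \in cover B).
Proof.
move=> BP; have cN := card_nbr_cycle5_copy w (copyP5 BP).
have spanE A : A \in P -> spans A B w -> w \in cover B /\ nbr B w \in A.
  move=> AP /existsP[x /existsP[y /and3P[xyA xB yB]]].
  have xy := copy_edge_neq (copyP5 AP) xyA.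
  have sub : [set x; y] \subset nbr B w by rewrite subUset !sub1set xB yB.
  have := subset_leq_card sub; rewrite cards2 xy cN.
  case: (w \in cover B) cN => // cN _; split=> //.
  suff <- : [set x; y] = nbr B w by [].
  by apply/eqP; rewrite eqEcard sub cards2 xy cN.
have [A /andP[AP AB]|none] := pickP (fun A => (A \in P) && spans A B w).
  have [-> NA] := spanE A AP AB.
  rewrite (bigD1 A) //= AB big1 // => A' /andP[A'P]; apply: contraNeq.
  rewrite eqb0 negbK => A'B; have [_ NA'] := spanE A' A'P A'B.
  by rewrite (trivIset_unique trivP A'P AP NA' NA).
by rewrite big1 // => A AP; move: (none A); rewrite AP /= => ->.
Qed.

Lemma packing_card_le : 25 * #|P| <= #|V| ^ 2 + 15 * #|V|.
Proof.
have sumS : \sum_w \sum_(A in P) \sum_(B in P) spans A B w <= 5 * #|P|.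
  rewrite -sum_multiplicity; apply: leq_sum => w _.
  by rewrite exchange_big; apply: leq_sum => B /sum_spans_le.
have : 2 * \sum_x multiplicity x ^ 2 <= 2 * #|V| * #|P| + 30 * #|P|.
  rewrite -sum_codegree exchange_big /=.
  apply: (@leq_trans (\sum_w \sum_(A in P)
      (2 + 3 * (w \in cover A) + 3 * \sum_(B in P) spans A B w))).
    by apply: leq_sum => w _; apply: leq_sum => A; exact: codegree_le.
  rewrite (eq_bigr (fun w => 2 * #|P| + 3 * multiplicity w +
      3 * \sum_(A in P) \sum_(B in P) spans A B w)) => [|w _]; last first.
    by rewrite 2!big_split /= sum_nat_const -!big_distrr /= mulnC.
  (* Incidences [w] on [A] and exceptional pairs each number at most $5|P|$; at weight 3 they give
     the error $30|P|$. *)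
  rewrite 2!big_split /= sum_nat_const -!big_distrr /= sum_multiplicity.
  have arith n p s : s <= 5 * p -> n * (2 * p) + 3 * (5 * p) + 3 * s <= 2 * n * p + 30 * p.
    by lia.
  exact: arith.
(* Together the hypotheses give $50p^2 \le n(2n + 30)p$; dividing by $2p$ requires treating $p = 0$
   apart. *)
have arith n p s :
    (5 * p) ^ 2 <= n * s -> 2 * s <= 2 * n * p + 30 * p -> 25 * p <= n ^ 2 + 15 * n.
  case: (posnP p) => [->//|p0] h1 h2; rewrite -(leq_pmul2r p0); nia.
by apply: arith; rewrite -sum_multiplicity; exact: sum_nat_sqr_le.
Qed.

End UpperBound.

(** * Lower bound: pentagons in a blow-up of the five-cycle *)

Section LowerBound.
Variables (V : finType) (m : nat) (enc : 'I_5 * 'I_m.+1 -> V).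
Hypothesis encI : injective enc.
Implicit Types (a b : 'I_m.+1) (x y w : V) (p q : 'I_m.+1 * 'I_m.+1).

(** The part size is a successor so that ['I_m.+1] carries addition modulo $m + 1$. Consecutive
    labels are $a, b$ or one of them with $a + b$, so cancellation recovers both. *)
Definition label p (i : 'I_5) : 'I_m.+1 :=
  match val i with 0 | 2 => p.1 | 4 => (p.1 + p.2)%R | _ => p.2 end.

Lemma label_inj p q (i j : 'I_5) :
  cycle_adj i j -> label p i = label q i -> label p j = label q j -> p = q.
Proof.
case: p q => [a b] [a' b'].
by case: i => [[|[|[|[|[|]]]]]] //= ?; case: j => [[|[|[|[|[|]]]]]] //= ? _;
  rewrite /label /=;
  first [ by move=> -> -> | by move=> -> /GRing.addrI -> | by move=> -> /GRing.addIr ->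
        | by move=> /[swap] -> /GRing.addrI -> | by move=> /[swap] -> /GRing.addIr -> ].
Qed.

Definition pentagon p : {set {set V}} :=
  [set [ffun i : cycle_graph 5 => enc (i, label p i)] @: e
     | e : {set cycle_graph 5} in edges (cycle_graph 5)].

Lemma pentagonP p (e : {set V}) :
  reflect (exists i j, cycle_adj i j /\ e = [set enc (i, label p i); enc (j, label p j)])
          (e \in pentagon p).
Proof.
apply: (iffP (copy_edgeP _ _)) => -[i [j [ij ->]]]; exists i, j; split=> //;
  by rewrite !ffunE.
Qed.

Lemma pentagon_copy p : pentagon p \in copies V (cycle_graph 5).
Proof. by apply/copyP; eexists; last reflexivity; move=> i j; rewrite !ffunE => /encI[]. Qed.

Lemma pentagon_unique p q (e : {set V}) : e \in pentagon p -> e \in pentagon q -> p = q.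
Proof.
case/pentagonP=> i [j [ij ->]] /pentagonP[i' [j' [_]]].
case/pair_set_eq=> -[/encI[<- Hi] /encI[<- Hj]]; exact: label_inj ij Hi Hj.
Qed.

Lemma pentagon_neq0 p : exists e, e \in pentagon p.
Proof.
exists [set enc (ord0, label p ord0); enc (ordS ord0, label p (ordS ord0))].
by apply/pentagonP; exists ord0, (ordS ord0).
Qed.

Definition blowup : {set {set {set V}}} := [set pentagon p | p : 'I_m.+1 * 'I_m.+1].

Lemma card_blowup : #|blowup| = m.+1 ^ 2.
Proof.
rewrite card_imset ?card_prod ?card_ord // => p q E.
by have [e ep] := pentagon_neq0 p; apply: (pentagon_unique ep); rewrite -E.
Qed.

Lemma packing_blowup : packing (cycle_graph 5) blowup.
Proof.
apply/andP; split.
  by apply/subsetP=> A /imsetP[p _ ->]; exact: pentagon_copy.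
apply/trivIsetP=> A B /imsetP[p _ ->] /imsetP[q _ ->]; apply: contraNT.
case/pred0Pn=> e /andP[/= ep eq]; by rewrite (pentagon_unique ep eq).
Qed.

Lemma blowup_edge x y : [set x; y] \in cover blowup ->
  exists i j u v, [/\ cycle_adj i j, x = enc (i, u) & y = enc (j, v)].
Proof.
case/bigcupP=> A /imsetP[p _ ->] /pentagonP[i [j [ij /pair_set_eq[][-> ->]]]].
  by exists i, j, (label p i), (label p j).
by exists j, i, (label p j), (label p i); rewrite cycle_adj_sym.
Qed.

(** Even a triangle that is not rainbow is impossible: projecting to the part indices would give a
    triangle in the five-cycle. *)
Lemma blowup_rainbow_free : ~~ [exists C, rainbow_copy (complete_graph 3) blowup C].
Proof.
apply/negP=> /existsP[C /and3P[/copyP[h _ CE] /subsetP sub _]].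
have edge (i j : 'I_3) : i != j -> [set h i; h j] \in cover blowup.
  by move=> ij; apply: sub; rewrite CE; apply/copy_edgeP; exists i, j.
have [i [j [u [v [ij h0 h1]]]]] := blowup_edge (edge (@Ordinal 3 0 isT) (@Ordinal 3 1 isT) isT).
have [i' [k [u' [w [ik + h2]]]]] := blowup_edge (edge (@Ordinal 3 0 isT) (@Ordinal 3 2 isT) isT).
rewrite h0 => /encI[ii' _]; subst i'.
have [j' [k' [v' [w' [jk]]]]] := blowup_edge (edge (@Ordinal 3 1 isT) (@Ordinal 3 2 isT) isT).
rewrite h1 h2 => /encI[jj' _] /encI[kk' _]; subst j' k'.
exact: cycle5_triangle_free ij ik jk.
Qed.

End LowerBound.

(** * Explicit bounds for the extremal number *)

Lemma exF_C5_K3_le n :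
  25 * exF (cycle_graph 5) n (complete_graph 3) <= n ^ 2 + 15 * n.
Proof.
rewrite /exF; elim/big_ind: _ => [//|a b|P /andP[pP rP]].
  by move=> ? ?; rewrite /maxn; case: ifP.
by have := packing_card_le pP rP; rewrite card_ord.
Qed.

Lemma exF_C5_K3_ge n :
  (n %/ 5) ^ 2 <= exF (cycle_graph 5) n (complete_graph 3).
Proof.
(* For $n < 5$ the bound is trivial; otherwise the five parts of size [m.+1] fit into ['I_n], and
   the leftover vertices stay isolated. *)
case E : (n %/ 5) => [|m] //.
have le_n : #|{: 'I_5 * 'I_m.+1}| <= n by rewrite card_prod !card_ord; lia.
pose enc (z : 'I_5 * 'I_m.+1) := widen_ord le_n (enum_rank z).
have encI : injective enc.
  by move=> z z' /(congr1 val) /= /val_inj /enum_rank_inj.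
rewrite -(card_blowup encI) /exF.
apply: (leq_bigmax_cond (F := fun P : {set {set {set 'I_n}}} => #|P|)).
by rewrite packing_blowup ?blowup_rainbow_free.
Qed.

(* Passage to the asymptotic statement *)
From mathcomp Require Import all_classical all_reals all_analysis.
Import numFieldNormedType.Exports.
Import Order.TTheory GRing.Theory Num.Theory.
Local Open Scope classical_set_scope.
Local Open Scope ring_scope.

Theorem theorem1p6 (R : realType) :
  exists o1 : nat -> R,
    o1 n @[n --> \oo] --> (0 : R) /\
    forall n : nat,
      (exF (cycle_graph 5) n (complete_graph 3))%:R
        = (1 + o1 n) * (n%:R ^+ 2 / 25%:R).
Proof.
set ex := fun n => exF (cycle_graph 5) n (complete_graph 3).
pose o1 n : R := 25 * (ex n)%:R / n%:R ^+ 2 - 1.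
have up n : 25 * (ex n)%:R <= n%:R ^+ 2 + 15 * n%:R :> R.
  by rewrite -!natrM -natrX -natrD ler_nat; exact: exF_C5_K3_le.
(* With $n = 5q + r$ and $r \le 4$, $n^2 - 25q^2 = r(10q + r) \le 8n$; the weaker $15n$ matches
   [up]. *)
have lo n : n%:R ^+ 2 <= 25 * (ex n)%:R + 15 * n%:R :> R.
  rewrite -!natrM -natrX -natrD ler_nat.
  have := exF_C5_K3_ge n; rewrite -/(ex n); nia.
exists o1; split; last first.
  move=> n; rewrite /o1 -/(ex n) addrC subrK.
  (* At $n = 0$ the quotient in [o1] is a division by zero, but [up] forces [ex 0] to vanish, so
     both sides are 0. *)
  have [->|n0] := eqVneq n 0%N.
    have := up 0%N; rewrite expr0n mulr0 addr0 pmulr_rle0 // => h.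
    by rewrite mul0r mulr0; apply/le_anti; rewrite h ler0n.
  by field; rewrite pnatr_eq0.
(* The shift to [n.+1] avoids $n = 0$, where [o1] is $-1$ and the bound would fail; it also matches
   the harmonic sequence. *)
have bound n : `|o1 n.+1| <= 15 * n.+1%:R^-1.
  have n0 : 0 < n.+1%:R :> R by rewrite ltr0n.
  rewrite /o1 -(ler_pM2r (exprn_gt0 2 n0)).
  rewrite -[X in _ * X <= _]gtr0_norm ?exprn_gt0 // -normrM.
  rewrite mulrBl divfK ?expf_neq0 ?gt_eqF // mul1r.
  rewrite expr2 -mulrA mulKf ?gt_eqF // -expr2.
  rewrite ler_norml; have := up n.+1; have := lo n.+1; lra.
have harm (c : R) : (c * n.+1%:R^-1) @[n --> \oo] --> (0 : R).
  rewrite -[0](mulr0 c); apply: cvgM; [exact: cvg_cst|exact: cvg_harmonic].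
rewrite -cvg_shiftS; apply: (squeeze_cvgr _ (harm (- 15)) (harm 15)).
by apply: nearW => n; rewrite mulNr -ler_norml; exact: bound.
Qed.
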